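(* Let $q$ be an indeterminate, $[n]=1+q+\dots+q^{n-1}$, $[n]!=[1]\cdots[n]$, and let $e_n(q)$ be defined by the power product expansion $\sum_{n\ge0}\frac{x^n}{[n]!}=\prod_{n\ge1}(1+e_n(q)x^n)$. Put $c_n(q)=[n]!\,e_n(q)$, and let $c_n$ be the integers with $\exp(x)=\sum_{n\ge0}\frac{x^n}{n!}=\prod_{n\ge1}\bigl(1+\frac{c_n}{n!}x^n\bigr)$. Let $n\ge m$ be positive integers and $\zeta_m=e^{2\pi i/m}$. If $n=mk$ then $c_{mk}(\zeta_m)=c_k$; if $n$ is not a multiple of $m$ then $c_n(\zeta_m)=0$.
   Context: A power product expansion of a formal power series $f(x)=\sum_{n\ge0}a_nx^n$ with $a_0=1$ is the unique representation $f(x)=\prod_{n\ge1}(1+g_nx^n)$. It is known (and shown in the paper) that each $c_n(q)=[n]!\,e_n(q)$ is a polynomial in $q$ with integer coefficients, so evaluation at $\zeta_m$ makes sense; $c_n=n!\,e_n$ with $e_n$ the power product coefficients of $\exp(x)$ are integers ($c_1,c_2,\dots=1,1,-2,9,-24,130,\dots$). *)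

(* Defs.v *)
From HB Require Import structures.
From mathcomp Require Import all_boot all_order all_algebra.
From mathcomp Require Import fraction complex reals trigo.

Set Implicit Arguments.
Unset Strict Implicit.
Unset Printing Implicit Defensive.

Import Order.TTheory GRing.Theory Num.Theory.
Local Open Scope ring_scope.

(* A formal power series is represented by its sequence of coefficients.
   [power_product a g] says that \sum_n a_n x^n = \prod_(n >= 1) (1 + g_n x^n):
   every coefficient of the partial products is eventually that of the series
   (convergence of formal power series). The value [g 0] is irrelevant. *)
Definition power_product (K : comNzRingType) (a g : nat -> K) : Prop :=
  forall n : nat, exists N0 : nat, forall N : nat, (N0 <= N)%N ->
    (\prod_(1 <= i < N.+1) (1 + g i *: 'X^i))`_n = a n.

(* The indeterminate q is 'X : {poly int}, and Q(q) is the fraction field of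
   Z[q]. *)
Notation Qq := {fraction {poly int}}.

Definition qnat (n : nat) : {poly int} := \sum_(i < n) 'X^i.

Definition qfact (n : nat) : {poly int} := \prod_(1 <= i < n.+1) qnat i.

Definition qexp (n : nat) : Qq := (tofrac (qfact n))^-1.

Definition zeta (R : realType) (m : nat) : R[i] :=
  Complex (cos (2 * pi / m%:R)) (sin (2 * pi / m%:R)).

Definition eval_int (R : realType) (p : {poly int}) (z : R[i]) : R[i] :=
  (map_poly intr p).[z].

(* Main.v *)
(* Put (x * y)_n = sum_i [n choose i]_q x_i y_(n-i), the product of series in the
   q-divided powers x^n/[n]!. In this ring the hypothesis says that the product P_N
   of the 1 + c_i x^i/[i]!, i <= N, has n-th coefficient 1 once N >= n; since
   P_n(n) = P_(n-1)(n) + c_n, the c_n are polynomials in q. At a primitive m-th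
   root of unity, the q-Lucas theorem gives
     P_N(n) = Q_(N %/ m)(n %/ m)   for N >= m - 1,
   where Q is the analogue of P for the exponential series, and comparing
   P_(n-1)(n) with P_n(n) = 1 yields c_n. *)
Require Import Defs.
From mathcomp Require Import all_boot all_order all_algebra.
From mathcomp Require Import fraction complex reals trigo.
From mathcomp Require Import boolp ring lra zify.
Import Order.TTheory GRing.Theory Num.Theory.
Local Open Scope ring_scope.

(** * q-integers, q-factorials and q-binomials over a commutative ring *)

Definition qint {R : comNzRingType} (q : R) (n : nat) : R := \sum_(i < n) q ^+ i.

Definition qfac {R : comNzRingType} (q : R) (n : nat) : R :=
  \prod_(1 <= i < n.+1) qint q i.

(** The Pascal recurrence replaces the quotient of q-factorials, which may vanish at roots of
    unity. *)
Fixpoint qbin {R : comNzRingType} (q : R) (n k : nat) : R :=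
  match n, k with
  | _, 0 => 1
  | 0, _.+1 => 0
  | n'.+1, k'.+1 => qbin q n' k' + q ^+ k * qbin q n' k
  end.

(* [qprod q c N n] is the coefficient of x^n/[n]! in the product of the
   1 + c_i x^i/[i]! over 1 <= i <= N. When n < N the subtraction is truncated,
   but then the q-binomial vanishes. *)
Fixpoint qprod {R : comNzRingType} (q : R) (c : nat -> R) (N n : nat) : R :=
  if N is N'.+1 then
    qprod q c N' n + qbin q n N * c N * qprod q c N' (n - N)
  else (n == 0)%:R.

Section QAnalogues.
Variables (R : comNzRingType) (q : R).

Lemma qfac0 : qfac q 0 = 1.
Proof. by rewrite /qfac big_geq. Qed.

Lemma qfacS n : qfac q n.+1 = qfac q n * qint q n.+1.
Proof. by rewrite /qfac big_nat_recr. Qed.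

Lemma qintD m n : qint q (m + n) = qint q m + q ^+ m * qint q n.
Proof.
rewrite /qint big_split_ord /= mulr_sumr; congr (_ + _).
by apply: eq_bigr => i _; rewrite exprD.
Qed.

Lemma qbin0 n : qbin q n 0 = 1.
Proof. by case: n. Qed.

Lemma qbin_small n k : (n < k)%N -> qbin q n k = 0.
Proof.
elim: n k => [|n IHn] [|k] //= ltnk.
by rewrite !IHn ?mulr0 ?addr0 // ltnW.
Qed.

Lemma qbinnn n : qbin q n n = 1.
Proof. by elim: n => //= n ->; rewrite qbin_small // mulr0 addr0. Qed.

(** Induction from [[n+1] = [k+1] + q^(k+1) [n-k]]; kept free of division because the factorials may
    be zero. *)
Lemma qbin_qfac n k :
  (k <= n)%N -> qbin q n k * (qfac q k * qfac q (n - k)) = qfac q n.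
Proof.
elim: n k => [|n IHn] [|k] // lekn; rewrite ?subn0 ?qbin0 ?qfac0 ?mul1r //.
have Dn : qint q n.+1 = qint q k.+1 + q ^+ k.+1 * qint q (n - k).
  by rewrite -qintD addSn subnKC.
rewrite [in RHS]qfacS Dn mulrDr subSS [qbin _ _ _]/= mulrDl; congr (_ + _).
  by rewrite qfacS -(IHn k lekn); ring.
move: lekn; rewrite ltnS leq_eqVlt => /predU1P[->|ltkn].
  by rewrite qbin_small // subnn /qint big_ord0 !(mulr0, mul0r).
by rewrite -(IHn k.+1 ltkn) -(subnSK ltkn) [qfac q (n - _).+1]qfacS; ring.
Qed.

Variable c : nat -> R.

Lemma qprodS N n :
  qprod q c N.+1 n =
  qprod q c N n + qbin q n N.+1 * c N.+1 * qprod q c N (n - N.+1).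
Proof. by []. Qed.

Lemma qprod0 N : qprod q c N 0 = 1.
Proof. by elim: N => //= N ->; rewrite !mul0r addr0. Qed.

Lemma qprod_stable N n : (n <= N)%N -> qprod q c N n = qprod q c n n.
Proof.
elim: N n => [|N IHN] n; first by rewrite leqn0 => /eqP ->.
rewrite leq_eqVlt => /predU1P[->//|ltnN].
by rewrite /= qbin_small // !mul0r addr0 IHN.
Qed.

Lemma qprodSn n : qprod q c n.+1 n.+1 = qprod q c n n.+1 + c n.+1.
Proof.
by rewrite qprodS qbinnn subnn qprod0 mul1r mulr1.
Qed.

End QAnalogues.

(** * Transport along ring morphisms *)

Section Morphisms.
Variables (R S : comNzRingType) (f : {rmorphism R -> S}) (q : R).

Lemma rmorph_qint n : f (qint q n) = qint (f q) n.
Proof. by rewrite rmorph_sum; apply: eq_bigr => i _; rewrite rmorphXn. Qed.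

Lemma rmorph_qfac n : f (qfac q n) = qfac (f q) n.
Proof. by rewrite rmorph_prod; apply: eq_bigr => i _; rewrite rmorph_qint. Qed.

Lemma rmorph_qbin n k : f (qbin q n k) = qbin (f q) n k.
Proof.
elim: n k => [|n IHn] [|k] /=; rewrite ?rmorph1 ?rmorph0 //.
by rewrite rmorphD rmorphM rmorphXn !IHn.
Qed.

(** Comparing only the indices from 1 to [N] lets this be applied while later coefficients are not
    yet known to be polynomials. *)
Lemma rmorph_qprod (c : nat -> R) (d : nat -> S) N n :
  (forall i, (0 < i <= N)%N -> f (c i) = d i) ->
  f (qprod q c N n) = qprod (f q) d N n.
Proof.
elim: N n => [|N IHN] n fcd; first by rewrite /= rmorph_nat.
have {}IHN k : f (qprod q c N k) = qprod (f q) d N k.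
  by apply: IHN => i /andP[i_gt0 leiN]; rewrite fcd // i_gt0 leqW.
by rewrite [in LHS]/= rmorphD !rmorphM rmorph_qbin !IHN fcd ?leqnn.
Qed.

End Morphisms.

(** * Specialization at q = 1 *)

Section QOne.
Variable R : comNzRingType.

Lemma qfac1 n : qfac (1 : R) n = n`!%:R.
Proof.
elim: n => [|n IHn]; first by rewrite qfac0.
rewrite qfacS IHn factS mulnC natrM; congr (_ * _).
rewrite /qint (eq_bigr (fun=> 1)) => [|i _]; last by rewrite expr1n.
by rewrite sumr_const card_ord.
Qed.

Lemma qbin1 n k : qbin (1 : R) n k = 'C(n, k)%:R.
Proof.
elim: n k => [|n IHn] [|k] //=.
by rewrite !IHn expr1n mul1r binS natrD addrC.
Qed.

End QOne.

(** * From the power product to q-divided powers *)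

Section Coefficients.
Variables (F : fieldType) (q : F).
Hypothesis qfac_neq0 : forall n, qfac q n != 0.

(** Multiplying by [[n]!] turns the Cauchy product into the q-binomial convolution, by
    [qbin_qfac]. *)
Lemma coef_prod_qprod (g : nat -> F) N n :
  (\prod_(1 <= i < N.+1) (1 + g i *: 'X^i))`_n =
  qprod q (fun i => qfac q i * g i) N n / qfac q n.
Proof.
elim: N n => [|N IHN] n.
  by rewrite big_geq // coef1 /=; case: eqP => [->|]; rewrite ?qfac0 ?divr1 ?mul0r.
rewrite big_nat_recr //= mulrDr mulr1 coefD IHN -scalerAr coefZ coefMXn.
case: ltnP => [ltnN|leNn].
  by rewrite qbin_small // !(mulr0, mul0r) !addr0.
rewrite IHN -(qbin_qfac _ q n N.+1 leNn) mulrDl; congr (_ + _).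
have := qfac_neq0 n; rewrite -(qbin_qfac _ q n N.+1 leNn) !mulf_eq0 !negb_or.
move=> /and3P[b0 f0 h0]; by field; rewrite b0 f0 h0.
Qed.

Lemma power_product_qprod (a g : nat -> F) :
  (forall n, a n = (qfac q n)^-1) -> power_product a g ->
  forall n, qprod q (fun i => qfac q i * g i) n n = 1.
Proof.
move=> Da ag n; have [N0 agn] := ag n.
have := agn (maxn N0 n) (leq_maxl _ _).
rewrite coef_prod_qprod (qprod_stable _ _ _ _ _ (leq_maxr _ _)) Da.
rewrite -[RHS]mul1r => /divIf; apply; exact: qfac_neq0.
Qed.

End Coefficients.

(** * Values at a primitive m-th root of unity *)

Section RootOfUnity.
Variables (F : idomainType) (q : F) (m : nat).
Hypothesis prim_q : m.-primitive_root q.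

Let m_gt0 : (0 < m)%N := prim_order_gt0 prim_q.

Lemma qint_prim_neq0 i : (0 < i < m)%N -> qint q i != 0.
Proof.
case/andP=> i_gt0 ltim; apply/negP => /eqP qi0.
have: q ^+ i - 1 == 0 by rewrite subrX1 -/(qint q i) qi0 mulr0.
by rewrite subr_eq0 -(prim_order_dvd prim_q) gtnNdvd.
Qed.

Lemma qfac_prim_neq0 i : (i < m)%N -> qfac q i != 0.
Proof.
elim: i => [|i IHi] ltim; first by rewrite qfac0 oner_neq0.
by rewrite qfacS mulf_neq0 ?IHi ?qint_prim_neq0 // ltnW.
Qed.

Lemma qint_prim_order : (1 < m)%N -> qint q m = 0.
Proof.
move=> m_gt1; have q1 : q - 1 != 0.
  by rewrite subr_eq0 -[q]expr1 -(prim_order_dvd prim_q) gtnNdvd.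
apply: (mulfI q1); rewrite mulr0 -subrX1; apply/eqP.
by rewrite subr_eq0 (prim_expr_order prim_q).
Qed.

(** In [qbin q m j * ([j]! [m-j]!) = [m]!] the right side vanishes through its factor [[m]], while
    [[j]!] and [[m-j]!] do not. *)
Lemma qbin_prim_order j : (0 < j < m)%N -> qbin q m j = 0.
Proof.
case/andP=> j_gt0 ltjm; have m_gt1 : (1 < m)%N by apply: leq_ltn_trans ltjm.
have := qbin_qfac _ q m j (ltnW ltjm).
rewrite -[X in _ = qfac q X](prednK m_gt0) qfacS prednK // qint_prim_order // mulr0.
move/eqP; rewrite !mulf_eq0 (negPf (qfac_prim_neq0 _ ltjm)) /=.
rewrite (negPf (qfac_prim_neq0 (m - j) _)) ?orbF; first by move/eqP.
by rewrite ltn_subrL j_gt0.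
Qed.

(* Both sides satisfy the q-Pascal recurrence: a carry in the lower (resp. upper)
   residue is absorbed by the vanishing of [qbin q r m.-1] for r < m.-1 (resp. of
   [qbin q m j] for 0 < j < m). *)
Lemma qLucas n j :
  qbin q n j = 'C(n %/ m, j %/ m)%:R * qbin q (n %% m) (j %% m).
Proof.
have last_mod i : (m %| i.+1)%N -> (i %% m)%N = m.-1.
  move=> dvdm; have := ltn_pmod i m_gt0.
  move: dvdm; rewrite /dvdn -addn1 -modnDml => /eqP.
  case: (ltnP (i %% m + 1) m) => [lt|]; last by lia.
  by rewrite modn_small // addn1.
elim: n j => [|n IHn] j.
  rewrite div0n mod0n; case: j => [|j]; first by rewrite div0n mod0n mulr1.
  rewrite modnS divnS //; case: ifP => _; last by rewrite mulr0.
  by rewrite bin0n mul0r.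
case: j => [|j]; first by rewrite div0n mod0n bin0 !qbin0 mulr1.
rewrite [LHS]/= !IHn -(prim_expr_mod prim_q j.+1) !modnS !divnS //.
case: (boolP (m %| j.+1)%N) => [dj|ndj]; case: (boolP (m %| n.+1)%N) => [dn|ndn].
- by rewrite !last_mod // qbinnn !qbin0 expr0 !mulr1 mul1r !add1n binS natrD addrC.
- rewrite (last_mod j) // qbin_small ?qbin0; first by rewrite expr0 mulr0 add0r mul1r.
  have lt1 := ltn_pmod n m_gt0; rewrite ltn_neqAle -ltnS prednK // lt1 andbT.
  apply: contra ndn => /eqP nm; rewrite /dvdn -addn1 -modnDml nm addn1 prednK //.
  by rewrite modnn.
- rewrite (last_mod n) // add0n [qbin q 0 _]/= mulr0.
  transitivity ('C(n %/ m, j %/ m)%:R * qbin q m.-1.+1 (j %% m).+1) => /=.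
    by ring.
  have := qbin_prim_order (j %% m).+1.
  rewrite -[X in qbin q X](prednK m_gt0) /= => ->; first by rewrite mulr0.
  have lt1 := ltn_pmod j m_gt0; rewrite ltn_neqAle lt1 andbT.
  apply: contra ndj => /eqP nm; rewrite /dvdn -addn1 -modnDml addn1 nm.
  by rewrite modnn.
- by rewrite !add0n /=; ring.
Qed.

(** Induction on [N]. In the term added at [N.+1], either the remaining degree is still at least
    [m], or [n %% m = n - m < N.+1] and the q-binomial vanishes by q-Lucas. *)
Lemma qprod_prim_small (z : nat -> F) N n :
  (N < m)%N -> (m <= n)%N -> qprod q z N n = 0.
Proof.
elim: N n => [|N IHN] n ltNm lemn.
  by rewrite /= gtn_eqF // (leq_trans m_gt0).
rewrite qprodS IHN ?(ltnW ltNm) // add0r.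
have [lemd|ltdm] := leqP m (n - N.+1); first by rewrite IHN ?(ltnW ltNm) // mulr0.
suff -> : qbin q n N.+1 = 0 by rewrite !mul0r.
have Dr : (n %% m)%N = (n - m)%N.
  by rewrite -{1}(subnKC lemn) modnDl modn_small //; lia.
by rewrite qLucas (modn_small ltNm) Dr qbin_small ?mulr0 //; lia.
Qed.

Variables (z c : nat -> F).
Hypothesis zP : forall n, qprod q z n n = 1.
Hypothesis cP : forall n, qprod 1 c n n = 1.

(** With [k = N %/ m], the hypothesis turns [z N.+1 = 1 - P_N(N+1)] into [1 - Q_k(k) = 0] or, when
    [m] divides [N.+1], into [1 - Q_k(k+1) = c k.+1]. It serves both inside the induction on [N] and
    after it. *)
Lemma coef_from_qprod N :
    (forall n, qprod q z N n = qprod 1 c (N %/ m) (n %/ m)) ->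
  z N.+1 = if (m %| N.+1)%N then c (N.+1 %/ m)%N else 0.
Proof.
move=> zN; have := zP N.+1; rewrite qprodSn zN divnS //.
case: (m %| _)%N; last first.
  by rewrite cP => /eqP; rewrite addrC -subr_eq0 addrK => /eqP.
rewrite add1n => zS.
by apply: (addrI (qprod 1 c (N %/ m) (N %/ m).+1)); rewrite zS -qprodSn cP.
Qed.

Lemma qprod_prim N n :
  (m <= N.+1)%N -> qprod q z N n = qprod 1 c (N %/ m) (n %/ m).
Proof.
move=> lemN; have -> : N = (m.-1 + (N - m.-1))%N by lia.
elim: (N - m.-1)%N n => [|t IHt] n {N lemN}.
  (* Base case [N = m.-1]: both sides are 1 for [n < m] and 0 for [n >= m]. *)
  rewrite addn0 (divn_small (_ : m.-1 < m)%N) ?prednK //=.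
  have [ltnm|lemn] := ltnP n m.
    by rewrite (divn_small ltnm) qprod_stable ?zP // -ltnS prednK.
  by rewrite qprod_prim_small ?prednK // gtn_eqF // divn_gt0.
rewrite addnS qprodS (coef_from_qprod _ IHt) !IHt divnS //.
case: ifP => dM; last by rewrite mulr0 mul0r addr0.
(* As [m] divides [N.+1], q-Lucas leaves just an ordinary binomial, the one in the recurrence for
   Q. *)
by rewrite qLucas (eqP dM) qbin0 mulr1 divnBr // divnS // dM add1n qprodS qbin1.
Qed.

Lemma coef_prim n :
  (m <= n)%N -> z n = if (m %| n)%N then c (n %/ m)%N else 0.
Proof.
case: n => [|n] lemn; first by rewrite leqNgt m_gt0 in lemn.
by apply: coef_from_qprod => k; apply: qprod_prim.
Qed.

End RootOfUnity.

(** * Primitivity of [zeta R m] *)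

Lemma zeta_prim (R : realType) m : (0 < m)%N -> m.-primitive_root (zeta R m).
Proof.
move=> m_gt0; pose t : R := 2 * pi / m%:R.
have mR0 : m%:R != 0 :> R by rewrite pnatr_eq0 -lt0n.
have zetaX i : zeta R m ^+ i = Complex (cos (t *+ i)) (sin (t *+ i)).
  elim: i => [|i IHi]; first by rewrite expr0 mulr0n cos0 sin0.
  rewrite exprS IHi mulrS cosD sinD; congr Complex; ring.
have tm : t *+ m = pi *+ 2 by rewrite -mulr_natr /t divfK // mulrC mulr_natr.
have zetam1 : zeta R m ^+ m = 1 by rewrite zetaX tm cos2pi sin2pi.
rewrite /primitive_root_of_unity m_gt0; apply/forallP => i; apply/eqP.
rewrite unity_rootE; have := ltn_ord i.
rewrite leq_eqVlt => /predU1P[->|ltim]; first by rewrite zetam1 !eqxx.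
rewrite (ltn_eqF ltim) zetaX eq_complex /=; apply/negbTE.
apply/negP => /andP[/eqP cos1 _].
(* The half angle lies strictly between 0 and pi, so its sine is positive, whereas [cos1] would
   force this sine to be 0. *)
have Dt : t *+ i.+1 = (pi * i.+1%:R / m%:R) *+ 2.
  by rewrite -mulr_natr -[_ *+ 2]mulr_natr /t; field.
have: 0 < sin (pi * i.+1%:R / m%:R : R).
  apply: sin_gt0_pi; rewrite divr_gt0 ?mulr_gt0 ?pi_gt0 ?ltr0n //=.
  by rewrite ltr_pdivrMr ?ltr0n // ltr_pM2l ?pi_gt0 // ltr_nat.
move: cos1; rewrite Dt cos_mulr2n.
have := cos2Dsin2 (pi * i.+1%:R / m%:R : R).
move: (cos _) (sin _) => x y; nra.
Qed.

(** * Integrality of the coefficients c_n(q) *)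

Lemma tofrac_qfact n : tofrac (qfact n) = qfac (tofrac 'X : Qq) n.
Proof. exact: (rmorph_qfac _ _ (@tofrac {poly int}) 'X n). Qed.

Lemma qfact_neq0 n : qfact n != 0.
Proof.
apply/negP => /eqP qn0.
(* Evaluation at q = 1 gives [n!], which is nonzero. *)
have := rmorph_qfac _ _ (horner_eval (1 : int)) 'X n.
rewrite -[qfac 'X n]/(qfact n) qn0 rmorph0 /= horner_evalE hornerX qfac1 => /esym/eqP.
by rewrite pnatr_eq0 eqn0Ngt fact_gt0.
Qed.

(** Strong induction. The guard [0 < n] comes after the witness because [d 0] is unconstrained and
    [choice] needs a polynomial for every index. *)
Lemma qexp_coef_integral (d : nat -> Qq) :
  (forall n, qprod (tofrac 'X) d n n = 1) ->
  forall n, exists p : {poly int}, (0 < n)%N -> tofrac p = d n.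
Proof.
move=> dP; elim/ltn_ind=> -[|n] IHn; first by exists 0.
have [p pd] : exists p : nat -> {poly int},
    forall i, (0 < i <= n)%N -> tofrac (p i) = d i.
  suff /choice[p pd] : forall i, exists p : {poly int},
      (0 < i <= n)%N -> tofrac p = d i by exists p.
  move=> i; have [lein|ltni] := leqP i n; last by exists 0; rewrite andbF.
  by have [p pd] := IHn i lein; exists p; rewrite andbT.
(* This solves [P_(n+1)(n+1) = P_n(n+1) + d n.+1 = 1] for the last coefficient. *)
exists (1 - qprod 'X p n n.+1) => _; rewrite rmorphB rmorph1.
rewrite (rmorph_qprod _ _ (@tofrac {poly int}) 'X p d _ _ pd).
by rewrite -(dP n.+1) qprodSn addrC addKr.
Qed.

Theorem theorem4p3 (R : realType) (e : nat -> Qq) (c : nat -> int)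
    (he : power_product qexp e)
    (hc : power_product (fun n => (n`!%:R)^-1 : rat)
                        (fun n => (c n)%:~R / n`!%:R))
    (m n : nat) (hm : (0 < m)%N) (hmn : (m <= n)%N) :
  exists cn : {poly int},
    [/\ tofrac cn = tofrac (qfact n) * e n,
        forall k : nat, n = (m * k)%N ->
          eval_int cn (zeta R m) = (c k)%:~R
      & ~~ (m %| n)%N -> eval_int cn (zeta R m) = 0].
Proof.
have qfac_neq0 k : qfac (tofrac 'X : Qq) k != 0.
  by rewrite -tofrac_qfact tofrac_eq0 qfact_neq0.
have qexpE k : qexp k = (qfac (tofrac 'X) k)^-1 by rewrite -tofrac_qfact.
have dP := power_product_qprod _ _ qfac_neq0 _ _ qexpE he.
have /choice[p pd] := qexp_coef_integral _ dP.
(* Since Z[q] embeds in Q(q), the identity descends to polynomials, where q can be specialized to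
   [zeta R m]. *)
have pP k : qprod 'X p k k = 1.
  apply/eqP; rewrite -(tofrac_eq (R := {poly int})) rmorph1 -(dP k); apply/eqP.
  by apply: (rmorph_qprod _ _ (@tofrac {poly int})) => i /andP[i0 _]; apply: pd.
have cP k : qprod 1 c k k = 1.
  apply: (@intr_inj rat).
  have f0 i : qfac (1 : rat) i != 0 by rewrite qfac1 pnatr_eq0 -lt0n fact_gt0.
  have fE i : (i`!%:R)^-1 = (qfac (1 : rat) i)^-1 by rewrite qfac1.
  rewrite rmorph1 -[RHS](power_product_qprod _ _ f0 _ _ fE hc k).
  pose f : {rmorphism int -> rat} := intr.
  rewrite -[X in _ = qprod X _ _ _](rmorph1 f).
  apply: (rmorph_qprod _ _ f) => i _; by rewrite mulrC qfac1 divfK // -qfac1.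
pose ev : {rmorphism {poly int} -> R[i]} :=
  horner_eval (zeta R m) \o map_poly (intr : int -> R[i]).
have evX : ev 'X = zeta R m by rewrite /ev /= map_polyX /horner_eval hornerX.
have zP k : qprod (zeta R m) (ev \o p) k k = 1.
  by rewrite -evX -(rmorph_qprod _ _ ev _ p) // pP rmorph1.
have cRP k : qprod 1 (fun i => (c i)%:~R : R[i]) k k = 1.
  pose f : {rmorphism int -> R[i]} := intr.
  have := rmorph_qprod _ _ f 1 c (f \o c) k k (fun _ _ => erefl).
  by rewrite cP !rmorph1.
have evE := coef_prim _ _ _ (zeta_prim R m hm) _ _ zP cRP n hmn.
exists (p n); split.
- by rewrite pd ?tofrac_qfact // (leq_trans hm).
- move=> k Dn; rewrite -[eval_int _ _]/((ev \o p) n) evE Dn.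
  by rewrite dvdn_mulr // mulKn.
- by move=> /negPf ndvd; rewrite -[eval_int _ _]/((ev \o p) n) evE ndvd.
Qed.
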